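(* Let $p,q$ be distinct odd primes, and let $\rho$ and $\sigma$ denote the unique nonnegative integers such that $\rho p+\sigma q=(p-1)(q-1)$. Then $$\mathrm{B}(pq^3)=\max\{\min\{p,q^3\},\ \mathrm{H}(\Phi_{p}(x)\Phi_{q}(x)\Phi_{pq^2}(x)\Phi_{q^{3}}(x))\},$$ i.e. $$\mathrm{B}(pq^3)=\begin{cases}\mathrm{H}(\Phi_{p}(x)\Phi_{q}(x)\Phi_{pq^{2}}(x)\Phi_{q^{3}}(x)), & \text{if } p<q,\\ \max\{p,\ \mathrm{H}(\Phi_{p}(x)\Phi_{q}(x)\Phi_{pq^{2}}(x)\Phi_{q^{3}}(x))\}, & \text{if } q<p<q^2,\\ p, & \text{if } q^2<p<q^3,\\ q^3, & \text{if } p>q^3.\end{cases}$$ Moreover, if $p<q$, then $\mathrm{B}(pq^3)=\max\{(\sigma+1)p,\ (p-(\sigma+1))p\}$.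
   Context: $\Phi_n(x)$ denotes the $n$-th cyclotomic polynomial. The height $\mathrm{H}(f)$ of a polynomial $f\in\mathbb{Z}[x]$ is the largest absolute value of its coefficients. For a positive integer $n$, $\mathrm{B}(n):=\max\{\mathrm{H}(f) : f\in\mathbb{Z}[x],\ f \mid x^{n}-1\}$. *)

(* Defs.v *)
From mathcomp Require Import all_boot all_order all_algebra all_field.
From mathcomp Require Import boolp classical_sets.
From mathcomp Require Import zify.

Set Implicit Arguments.
Unset Strict Implicit.
Unset Printing Implicit Defensive.

Import Order.TTheory GRing.Theory Num.Theory.
Local Open Scope ring_scope.

Definition polyheight (f : {poly int}) : nat := (\max_(i < size f) `|(f`_i)%R|)%N.

(* Genuine divisibility in Z[x]: polydiv's [f %| g] is pseudo-divisibility over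
   int, for which the constant 2 divides ['X^n - 1]. *)
Definition dvdZX (f g : {poly int}) : Prop := exists h : {poly int}, g = h * f.

Definition is_max_divisor_height (n m : nat) : Prop :=
  (exists2 f : {poly int}, dvdZX f ('X^n - 1) & polyheight f = m) /\
  (forall f : {poly int}, dvdZX f ('X^n - 1) -> (polyheight f <= m)%N).

(* The maximum exists for every n > 0, see [max_divisor_heightP] below; for
   n = 0 every polynomial divides ['X^n - 1 = 0] and the value is junk. *)
Definition max_divisor_height (n : nat) : nat :=
  xget 0%N [set m | is_max_divisor_height n m]%classic.

Lemma coef_prod_XsubC_norm1 (s : seq algC) (i : nat) :
  {in s, forall z, `|z| = 1} ->
  `|(\prod_(z <- s) ('X - z%:P))`_i| <= (2 ^ size s)%:R.
Proof.
elim: s i => [|z s IH] i s1.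
  by rewrite big_nil coef1; case: eqP => _; rewrite ?normr1 ?normr0 ?ler01.
have z1 : `|z| = 1 by apply: s1; rewrite mem_head.
have {}IH j := IH j (fun y ys => s1 y (mem_behead (s := z :: s) ys)).
rewrite big_cons mulrBl coefB coefXM coefCM /= expnS mul2n -addnn natrD.
apply: le_trans (ler_normB _ _) _; rewrite normrM z1 mul1r lerD ?IH //.
by case: eqP => // _; rewrite normr0 ler0n.
Qed.

Lemma polyheight_dvd_bound (n : nat) (f : {poly int}) :
  (0 < n)%N -> dvdZX f ('X^n - 1) -> (polyheight f <= 2 ^ n)%N.
Proof.
move=> n0 [h fh]; apply/bigmax_leqP => i _.
have [z zP] := C_prim_root_exists n0.
pose F := map_poly (intr : int -> algC) f.
have FX : F %| \prod_(k <- index_iota 0 n) ('X - (z ^+ k)%:P).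
  rewrite (factor_Xn_sub_1 zP); apply/dvdpP; exists (map_poly intr h).
  by rewrite -rmorphM -fh rmorphB rmorph1 /= map_polyXn.
have [m Fm] := dvdp_prod_XsubC FX.
have lf1 : `|lead_coef F| = 1.
  rewrite lead_coef_map_inj ?rmorph0 //; last exact: intr_inj.
  have := congr1 (fun g => absz (lead_coef g)) fh.
  rewrite lead_coefM lead_coefXnsubC // abszM => /esym/eqP.
  rewrite muln_eq1 => /andP[_ /eqP lf1].
  by rewrite -intr_norm -abszE lf1.
pose s := [seq z ^+ k | k <- mask m (index_iota 0 n)].
have FE : F = lead_coef F *: \prod_(y <- s) ('X - y%:P).
  have /eqpP[[a b] /= /andP[a0 b0] E] := Fm.
  rewrite big_map; set g := \prod_(_ <- _) _ in E *.
  have mg : g \is monic by apply: monic_prod => k _; apply: monicXsubC.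
  have := congr1 (@lead_coef _) E; rewrite !lead_coefZ (monicP mg) mulr1 => lE.
  by apply: (scalerI a0); rewrite E scalerA lE.
have s1 : {in s, forall y, `|y| = 1}.
  move=> y /mapP[k _ ->]; rewrite normrX.
  have /eqP z1 : `|z| ^+ n == 1 by rewrite -normrX (prim_expr_order zP) normr1.
  suff -> : `|z| = 1 by rewrite expr1n.
  by apply/eqP; rewrite -(pexpr_eq1 n0) ?normr_ge0 // z1.
have sn : (size s <= n)%N.
  rewrite size_map; apply: leq_trans (size_subseq (mask_subseq _ _)) _.
  by rewrite size_iota subn0.
have Fi : `|F`_i| <= (2 ^ size s)%:R.
  by rewrite FE coefZ normrM lf1 mul1r coef_prod_XsubC_norm1.
apply: leq_trans (leq_pexp2l _ sn) => //.
rewrite -(ler_nat algC); apply: le_trans Fi.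
by rewrite coef_map /= -intr_norm -abszE.
Qed.

Lemma max_divisor_heightP (n : nat) :
  (0 < n)%N -> is_max_divisor_height n (max_divisor_height n).
Proof.
move=> n0; apply: (xgetPex 0%N).
pose P m := `[< exists2 f, dvdZX f ('X^n - 1) & polyheight f = m >].
have exP : exists m, P m.
  exists (polyheight 1); apply/asboolP; exists 1 => //.
  by exists ('X^n - 1); rewrite mulr1.
have ubP m : P m -> (m <= 2 ^ n)%N.
  by move=> /asboolP[f fd <-]; apply: polyheight_dvd_bound.
case: (ex_maxnP exP ubP) => m /asboolP Pm maxm.
exists m; split=> // f fd; apply: maxm; apply/asboolP.
by exists f.
Qed.

(* In particular rs.2 < p - 1, so [p - (rs.2 + 1)] is never truncated. *)
Lemma frobenius_pair (p q : nat) : prime p -> prime q -> p != q ->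
  exists! rs : nat * nat, (rs.1 * p + rs.2 * q = (p - 1) * (q - 1))%N.
Proof.
move=> pp pq npq; have p1 := prime_gt1 pp; have q1 := prime_gt1 pq.
have cqp : coprime q p by rewrite prime_coprime // dvdn_prime2 // eq_sym.
set N := ((p - 1) * (q - 1))%N.
have NE : (N + p + q = p * q + 1)%N by rewrite /N; nia.
have [u uq] : exists u, (u * q = 1 %[mod p])%N.
  have [u v uv _] := egcdnP p (ltnW q1).
  by exists u; rewrite uv (eqP cqp) modnMDl.
pose t := ((u * N) %% p)%N.
have tp : (t < p)%N by rewrite ltn_mod; lia.
have tN : (t * q = N %[mod p])%N.
  by rewrite /t modnMml -mulnA [(N * q)%N]mulnC mulnA -modnMml uq modnMml mul1n.
clearbody t N.
have tqN : (t * q <= N)%N.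
  rewrite leqNgt; apply/negP => ltN.
  have : (p %| t * q - N)%N by rewrite -eqn_mod_dvd ?(ltnW ltN) //; apply/eqP.
  move=> /dvdn_leq; rewrite subn_gt0 => /(_ ltN).
  have {tp} : (t.+1 * q <= p * q)%N by rewrite leq_mul2r tp orbT.
  by move: NE ltN; rewrite mulSn; move: (t * q)%N (p * q)%N => a b; lia.
have pd : (p %| N - t * q)%N by rewrite -eqn_mod_dvd //; apply/eqP.
exists ((N - t * q) %/ p, t)%N; split=> /= [|[r' t'] /= e].
  by rewrite divnK // subnK.
have tt' : t = t'.
  have lt' : (t' < p)%N.
    rewrite -(ltn_pmul2r (ltnW q1)); move: NE; rewrite -e.
    by move: (r' * p)%N (t' * q)%N (p * q)%N => a b c; lia.
  have : (t' * q = t * q %[mod p])%N by rewrite tN -e modnMDl.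
  have inv x : (x < p)%N -> x = (x * q * u %% p)%N.
    by move=> xp; rewrite -mulnA [(q * u)%N]mulnC -modnMmr uq modnMmr muln1 modn_small.
  move=> ett; rewrite (inv t) // (inv t') //.
  by rewrite -modnMml -ett modnMml.
by rewrite -tt' -e -tt' addnK mulnK //; lia.
Qed.

(* Main.v *)
(* Substituting the relations between cyclotomic polynomials, every divisor of x^(pq^3) - 1 is, up
   to sign, a four letter word over subsets of {Phi_q, Phi_pq} (of {Phi_1, Phi_p} for the first
   letter), the k-th letter being evaluated at x^(q^(k-1)). As power series in x, a letter acts
   on the tail g of the word by g |-> g(x^q) times a quotient of powers of 1 - x, 1 - x^p, 1 - x^q
   and 1 - x^(pq), so on coefficients it is either harmless (it repeats or interleaves
   coefficients) or a difference, along an index function with increments u and u - p, where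
   u = 1/q mod p, of the partial sums of the tail. Flat tails have 1-Lipschitz partial sums,
   so one such step costs at most a factor p; a window sum of length p costs another factor p.
   The only word for which both costs are incurred is Phi_p Phi_q Phi_{pq^2} Phi_{q^3}: the height
   of any other word is at most p. Independently, the factors Phi_p and Phi_{pq^k} of a word have a
   flat product and each Phi_{q^k} multiplies the height by at most q, which bounds every word
   by q^3 and the exceptional one by q^2. *)
Require Import Defs.
From mathcomp Require Import all_boot all_order all_algebra all_field.
From mathcomp Require Import boolp zify ring.
Import Order.TTheory GRing.Theory Num.Theory.

Set Implicit Arguments.
Unset Strict Implicit.
Unset Printing Implicit Defensive.

Local Open Scope ring_scope.

(** * Operations on power series with integer coefficients *)

(* A function int -> int stands for the series with these coefficients: [diff k] multiplies by
   1 - x^k, [psum] divides by 1 - x, [up m] substitutes x^m, and [spread k m w] is the series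
   G(x^m) / (1 - x^k), where G(y) = (1 - y^k) w(y). *)
Definition causal (c : int -> int) := forall n, n < 0 -> c n = 0.

Definition diff (k : nat) (c : int -> int) (n : int) : int := c n - c (n - k%:Z).

Definition psum (c : int -> int) (n : int) : int :=
  if n is Posz m then \sum_(i < m.+1) c i else 0.

Definition up (m : nat) (c : int -> int) (n : int) : int :=
  if (m %| n)%Z then c (n %/ m)%Z else 0.

(* For coprime k and m, the largest j such that m * j <= n and m * j = n modulo k. *)
Definition idx (k m : nat) (n : int) : int :=
  (n %/ m)%Z - (((n %/ m)%Z - (egcdz m k).1 * n) %% k)%Z.

Definition spread (k m : nat) (w : int -> int) (n : int) : int := w (idx k m n).

Definition pulse (n : int) : int := (n == 0)%R%:Z.

Definition idx_spec (k m : nat) (n j : int) :=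
  (exists a : int, n - m%:Z * j = k%:Z * a) /\ 0 <= n - m%:Z * j < (m * k)%N%:Z.

(** With u an inverse of m modulo k, the index must be u * n modulo k, and subtracting s = (n %/ m -
    u * n) %% k from the quotient reaches that class. The remainder is then r + m * s with 0 <= r <
    m and 0 <= s < k, hence in [0, m * k). *)
Lemma idxP (k m : nat) n : coprime k m -> (0 < k)%N -> (0 < m)%N -> idx_spec k m n (idx k m n).
Proof.
move=> ckm k0 m0; rewrite /idx_spec /idx; case: egcdzP => u v /= uv _.
have {}uv : u * m%:Z + v * k%:Z = 1.
  by rewrite uv /gcdz /= gcdnC (eqP ckm).
have eN := divz_eq n m.
have mN0 : m%:Z != 0 by lia.
have kN0 : k%:Z != 0 by lia.
have rN := modz_ge0 n mN0; have rN' := ltz_pmod n (_ : 0 < m%:Z).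
have {}rN' : (n %% m)%Z < m%:Z by apply: rN'; lia.
set N := (n %/ m)%Z in eN *; set r := (n %% m)%Z in eN rN rN'.
set t := N - u * n.
have et := divz_eq t k.
have tN := modz_ge0 t kN0; have tN' : (t %% k)%Z < k%:Z by apply: ltz_pmod; lia.
set s := (t %% k)%Z in et tN tN' *; set d := (t %/ k)%Z in et.
split.
  exists (v * n - m%:Z * d).
  have -> : s = t - d * k%:Z by rewrite et; ring.
  rewrite /t; have : n = (u * m%:Z + v * k%:Z) * n by rewrite uv mul1r.
  move=> E; rewrite {1}E; ring.
have -> : n - m%:Z * (N - s) = r + m%:Z * s by rewrite {1}eN; ring.
rewrite PoszM; nia.
Qed.

(** Two candidates differ by a multiple of k, while m times their difference is below m * k in
    absolute value. *)
Lemma idx_uniq (k m : nat) n j : coprime k m -> (0 < k)%N -> (0 < m)%N ->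
  idx_spec k m n j -> idx k m n = j.
Proof.
move=> ckm k0 m0 [[a Ha] Hj]; have [[b Hb] Hi] := idxP n ckm k0 m0.
move: (idx k m n) Hb Hi => i Hb Hi.
have E : m%:Z * (j - i) = k%:Z * (b - a) by rewrite !mulrBr -Ha -Hb; ring.
have : (k %| j - i)%Z.
  have: (k %| m%:Z * (j - i))%Z by rewrite E dvdz_mulr.
  by rewrite Gauss_dvdzr.
move=> /dvdzP[c Ec].
have Em : m%:Z * (j - i) = (m * k)%N%:Z * c by rewrite Ec PoszM; ring.
have M0 : (0 < m * k)%N by rewrite muln_gt0 m0.
have c0 : c = 0.
  move: (m * k)%N Hj Hi Em M0 => M Hj Hi Em M0.
  have : - M%:Z < M%:Z * c < M%:Z by rewrite -Em mulrBr; lia.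
  by nia.
by rewrite c0 mul0r in Ec; lia.
Qed.

Lemma idx_lt0 (k m : nat) n : coprime k m -> (0 < k)%N -> (0 < m)%N ->
  n < 0 -> idx k m n < 0.
Proof. by move=> c k0 m0 n0; have [_ H] := idxP n c k0 m0; nia. Qed.

Lemma causal_diff k c : causal c -> causal (diff k c).
Proof. by move=> cc n n0; rewrite /diff !cc //; lia. Qed.

Lemma causal_psum c : causal (psum c).
Proof. by case. Qed.

Lemma causal_up m c : causal c -> causal (up m c).
Proof.
move=> cc n n0; rewrite /up; case: ifP => // /dvdzP[d dE].
case: (posnP m) => [m0|m0]; first by move: n0; rewrite dE m0 mulr0.
rewrite dE mulzK; last by lia.
by apply: cc; nia.
Qed.

Lemma causal_spread k m w : coprime k m -> (0 < k)%N -> (0 < m)%N ->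
  causal w -> causal (spread k m w).
Proof. by move=> c k0 m0 cw n n0; apply/cw/idx_lt0. Qed.

Lemma causal_pulse : causal pulse.
Proof. by move=> n n0; rewrite /pulse; case: eqP => //; lia. Qed.

#[local] Hint Resolve causal_diff causal_psum causal_up causal_spread causal_pulse : core.

(** Induction from the left cancels 1 - x^k on causal sequences. Identities between quotients are
    checked below by clearing denominators in this way. *)
Lemma diff_inj (k : nat) (a b : int -> int) : (0 < k)%N -> causal a -> causal b ->
  diff k a = diff k b -> a = b.
Proof.
move=> k0 ca cb E; apply: funext => n.
have [N] : exists N : nat, n < N%:Z by exists `|n|%N.+1; lia.
elim: N n => [|N IH] n nN; first by rewrite ca ?cb.
have := congr1 (fun f => f n) E; rewrite /diff (IH (n - k%:Z)); last by lia.
by move/addIr.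
Qed.

Lemma diffC j k c : diff j (diff k c) = diff k (diff j c).
Proof.
apply: funext => n; rewrite /diff.
have -> : n - k%:Z - j%:Z = n - j%:Z - k%:Z by ring.
ring.
Qed.

Lemma diff_psum c : causal c -> diff 1 (psum c) = c.
Proof.
move=> cc; apply: funext => -[[|n]|n]; rewrite /diff.
- by rewrite /= big_ord_recl big_ord0 subr0 addr0.
- have -> : n.+1%:Z - 1%N%:Z = n by lia.
  by rewrite [psum c n.+1]big_ord_recr /= addrAC subrr add0r.
by rewrite !causal_psum ?cc //; lia.
Qed.

Lemma psum_diff c : causal c -> psum (diff 1 c) = c.
Proof.
by move=> cc; apply: (@diff_inj 1) => //; rewrite diff_psum //; apply: causal_diff.
Qed.

Lemma psum_spec w c : causal w -> diff 1 w = c -> psum c = w.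
Proof. by move=> cw <-; apply: psum_diff. Qed.

Lemma diff_psumC k c : causal c -> diff k (psum c) = psum (diff k c).
Proof.
by move=> cc; apply/esym/psum_spec; [apply: causal_diff | rewrite diffC diff_psum].
Qed.

Lemma up_diff k m c : (0 < m)%N -> up m (diff k c) = diff (m * k) (up m c).
Proof.
move=> m0; apply: funext => n; rewrite {2}/diff /up PoszM.
rewrite rpredBr ?dvdz_mulr //; case: ifP => [/dvdzP[d ->]|_]; last by rewrite subr0.
rewrite /diff mulzK; last by lia.
by rewrite [m%:Z * _]mulrC -mulrBl mulzK; last by lia.
Qed.

(** Let j be the index of n. If n = m * j, the index of n - k is j - k. Otherwise n - m * j is a
    positive multiple of k, so n - k keeps the index j, and n cannot be a multiple of m: both sides
    vanish. *)
Lemma diff_spread k m w : coprime k m -> (0 < k)%N -> (0 < m)%N ->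
  diff k (spread k m w) = up m (diff k w).
Proof.
move=> c k0 m0; apply: funext => n; rewrite /diff /spread /up.
have [[a Ha] Hj] := idxP n c k0 m0.
move: (idx k m n) Ha Hj => j Ha Hj; have mN0 : m%:Z != 0 by lia.
case: (ltP (n - m%:Z * j) k%:Z) => nk.
  have a0 : a = 0 by nia.
  have {a Ha a0 Hj nk} -> : n = j * m%:Z by rewrite mulrC; move: Ha; rewrite a0; lia.
  rewrite dvdz_mull // mulzK //; congr (_ - w _).
  apply: idx_uniq => //; split; first by exists (m%:Z - 1); ring.
  have -> : j * m%:Z - k%:Z - m%:Z * (j - k%:Z) = k%:Z * (m%:Z - 1) by ring.
  by rewrite PoszM; nia.
have -> : idx k m (n - k%:Z) = j.
  apply: idx_uniq => //; split; first by exists (a - 1); rewrite mulrBr -Ha; ring.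
  by lia.
rewrite subrr; case: ifP => // /dvdzP[b Eb].
have E : m%:Z * (b - j) = k%:Z * a by rewrite -Ha Eb; ring.
have : (k %| b - j)%Z.
  have: (k %| m%:Z * (b - j))%Z by rewrite E dvdz_mulr.
  by rewrite Gauss_dvdzr.
move=> /dvdzP[d Ed]; move: Hj nk; rewrite Ha -E Ed PoszM.
move=> Hj nk; have d1 : d < 1 by nia.
by nia.
Qed.

(** The two remainders k * a and k * b combine to k * (a + m * b) with digits 0 <= a < m and 0 <= b
    < m', a mixed radix expansion of a number below m * m'. *)
Lemma spread_comp k m m' w : coprime k m -> coprime k m' ->
  (0 < k)%N -> (0 < m)%N -> (0 < m')%N ->
  spread k m (spread k m' w) = spread k (m * m') w.
Proof.
move=> c c' k0 m0 m0'; apply: funext => n; rewrite /spread; congr w.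
apply/esym/idx_uniq; rewrite ?coprimeMr ?c ?muln_gt0 ?m0 //.
have [[a Ha] Hj] := idxP n c k0 m0; move: (idx k m n) Ha Hj => j Ha Hj.
have [[b Hb] Hi] := idxP j c' k0 m0'; move: (idx k m' j) Hb Hi => i Hb Hi.
have E : n - (m * m')%N%:Z * i = k%:Z * (a + m%:Z * b).
  by rewrite mulrDr -Ha mulrCA -Hb PoszM; ring.
split; first by exists (a + m%:Z * b).
rewrite E; move: Hj Hi; rewrite Ha Hb !PoszM => Hj Hi.
have a0 : 0 <= a < m%:Z by nia.
have b0 : 0 <= b < m'%:Z by nia.
have : 0 <= a + m%:Z * b < m%:Z * m'%:Z by nia.
by move: (a + m%:Z * b) (m%:Z * m'%:Z) => x y; nia.
Qed.

(** * Ranges of coefficients *)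

Definition ranges (a b : int) (c : int -> int) := forall n, a <= c n <= b.

Definition bounded (M : nat) (c : int -> int) := forall n, `|c n| <= M%:Z.

Lemma bounded_ranges a b M c : ranges a b c -> - M%:Z <= a -> b <= M%:Z -> bounded M c.
Proof. by move=> rc aM bM n; have := rc n; lia. Qed.

Lemma bounded_leq M N c : (M <= N)%N -> bounded M c -> bounded N c.
Proof. by move=> MN cM n; have := cM n; lia. Qed.

Lemma ranges_spread a b k m w : ranges a b w -> ranges a b (spread k m w).
Proof. by move=> rw n; apply: rw. Qed.

Lemma bounded_spread M k m w : bounded M w -> bounded M (spread k m w).
Proof. by move=> rw n; apply: rw. Qed.

Lemma ranges_up a b m c : a <= 0 -> 0 <= b -> ranges a b c -> ranges a b (up m c).
Proof. by move=> a0 b0 rc n; rewrite /up; case: ifP => _; [apply: rc | rewrite a0]. Qed.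

Lemma bounded_up M m c : bounded M c -> bounded M (up m c).
Proof. by move=> rc n; rewrite /up; case: ifP => _; [apply: rc | rewrite normr0]. Qed.

Lemma bounded_diff a b M k c : ranges a b c -> b - a <= M%:Z -> bounded M (diff k c).
Proof. by move=> rc abM n; rewrite /diff; have := rc n; have := rc (n - k%:Z); lia. Qed.

Lemma bounded_diff1 M k c : (1 < M)%N -> bounded 1 c -> bounded M (diff k c).
Proof. by move=> M1 bc n; rewrite /diff; have := bc n; have := bc (n - k%:Z); lia. Qed.

(** As m does not divide k, the supports of [up m c] and of its shift by k are disjoint. *)
Lemma bounded_diff_up M m k c : ~~ (m %| k)%N -> bounded M c -> bounded M (diff k (up m c)).
Proof.
move=> mk bc n; rewrite /diff /up.
case: ifP => m1; case: ifP => m2; rewrite ?subr0 ?sub0r ?normrN ?normr0 //.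
have : (m %| k%:Z)%Z by have := rpredB m1 m2; rewrite opprB addrC subrK.
by move=> m3; case/negP: mk.
Qed.

Lemma diff_windowE k w n : diff k w n = \sum_(i < k) diff 1 w (n - i%:Z).
Proof.
elim: k => [|k IH]; first by rewrite big_ord0 /diff subr0 subrr.
rewrite big_ord_recr /= -IH /diff; have -> : n - k%:Z - 1%N%:Z = n - k.+1%:Z by lia.
by ring.
Qed.

Lemma windowE k c n : causal c -> diff k (psum c) n = \sum_(i < k) c (n - i%:Z).
Proof. by move=> cc; rewrite diff_windowE diff_psum. Qed.

Lemma bounded_window M k c : causal c -> bounded M c -> bounded (k * M) (diff k (psum c)).
Proof.
move=> cc bc n; rewrite windowE //; apply: le_trans (ler_norm_sum _ _ _) _.
apply: le_trans (_ : \sum_(i < k) M%:Z <= _); first by apply: ler_sum => i _.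
by rewrite sumr_const card_ord -mulr_natl PoszM natz.
Qed.

Lemma bounded_window1 k c : causal c -> bounded 1 c -> bounded k (diff k (psum c)).
Proof. by move=> cc /(bounded_window k cc); rewrite muln1. Qed.

(** * Lipschitz sequences along the index function *)

Lemma ranges_lipschitz w a b : ranges 0 1 (diff 1 w) -> b <= a -> 0 <= w a - w b <= a - b.
Proof.
move=> lw ba; have [k ->] : exists k : nat, b = a - k%:Z by exists `|a - b|%N; lia.
have := diff_windowE k w a; rewrite {1}/diff => ->; apply/andP; split.
  by apply: sumr_ge0 => i _; have /andP[] := lw (a - i%:Z).
have -> : a - (a - k%:Z) = \sum_(i < k) 1 by rewrite sumr_const card_ord natz; lia.
by apply: ler_sum => i _; have /andP[] := lw (a - i%:Z).
Qed.

Lemma bounded_lipschitz w a b : bounded 1 (diff 1 w) -> `|w a - w b| <= `|a - b|.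
Proof.
move=> lw; wlog ba : a b / b <= a => [IH|].
  by case: (leP b a) => ab; [|rewrite distrC [leRHS]distrC]; apply: IH => //; apply: ltW.
have [k ->] : exists k : nat, b = a - k%:Z by exists `|a - b|%N; lia.
have := diff_windowE k w a; rewrite {1}/diff => ->.
apply: le_trans (ler_norm_sum _ _ _) _.
have -> : `|a - (a - k%:Z)| = \sum_(i < k) 1 by rewrite sumr_const card_ord natz; lia.
by apply: ler_sum => i _; apply: lw.
Qed.

Lemma inverse_mod p m : coprime p m -> (1 < p)%N ->
  exists u r : nat, (0 < u < p)%N /\ (u * m = p * r + 1)%N.
Proof.
move=> cpm p1; have m0 : (0 < m)%N by case: m cpm => //; rewrite /coprime gcdn0; lia.
have [u v uv _] := egcdnP p m0; rewrite gcdnC (eqP cpm) in uv.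
have E : (((u %% p) * m) %% p = 1)%N by rewrite modnMml uv [X in (X + _)%N]mulnC mulnC modnMDl modn_small.
exists (u %% p)%N, ((u %% p * m) %/ p)%N; split.
  rewrite ltn_mod (ltnW p1) andbT lt0n; apply/eqP => u0.
  by move: E; rewrite u0 mul0n mod0n.
by rewrite {1}(divn_eq (u %% p * m) p) E mulnC.
Qed.

(** The index of n is u * n modulo p, so its increment is u modulo p; the bounds on the remainders
    confine it to (-p, p]. *)
Lemma idx_step p m u r n : coprime p m -> (0 < m)%N -> (0 < u < p)%N -> (u * m = p * r + 1)%N ->
  idx p m n - idx p m (n - 1) = u%:Z \/ idx p m n - idx p m (n - 1) = u%:Z - p%:Z.
Proof.
move=> c m0 up um; have p0 : (0 < p)%N by lia.
have [[a Ha] Hi] := idxP n c p0 m0; have [[b Hb] Hj] := idxP (n - 1) c p0 m0.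
move: (idx p m n) (idx p m (n - 1)) Ha Hi Hb Hj => i j Ha Hi Hb Hj.
have E : m%:Z * (i - j - u%:Z) = p%:Z * (b - a - r%:Z).
  have : u%:Z * m%:Z = p%:Z * r%:Z + 1 by rewrite -!PoszM um.
  move=> um'; rewrite !mulrBr -Ha -Hb [m%:Z * u%:Z]mulrC um'; ring.
have : (p %| i - j - u%:Z)%Z.
  have: (p %| m%:Z * (i - j - u%:Z))%Z by rewrite E dvdz_mulr.
  by rewrite Gauss_dvdzr.
move=> /dvdzP[d Ed].
have lo : - p%:Z < i - j by move: Hi Hj; rewrite PoszM; nia.
have hi : i - j <= p%:Z by move: Hi Hj; rewrite PoszM; nia.
have : d = 0 \/ d = -1 by nia.
by case=> dE; [left|right]; rewrite dE in Ed; lia.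
Qed.

Lemma bounded_diff_spread p m w : coprime p m -> (1 < p)%N -> (0 < m)%N ->
  bounded 1 (diff 1 w) -> bounded p (diff 1 (spread p m w)).
Proof.
move=> c p1 m0 lw n; have [u [r [up um]]] := inverse_mod c p1.
rewrite /diff /spread; apply: le_trans (bounded_lipschitz _ _ lw) _.
by have [->|->] := idx_step n c m0 up um; lia.
Qed.

(** When w is nondecreasing, the sign of the index increment survives and the range has width p
    instead of 2 * p, so a further difference still costs only p. *)
Lemma ranges_diff_spread p m w u r : coprime p m -> (0 < m)%N ->
  (0 < u < p)%N -> (u * m = p * r + 1)%N ->
  ranges 0 1 (diff 1 w) -> ranges (u%:Z - p%:Z) u%:Z (diff 1 (spread p m w)).
Proof.
move=> c m0 up um lw n; rewrite /diff /spread.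
have := idx_step n c m0 up um; move: (idx _ _ _) (idx _ _ _) => a b.
by case: (leP b a) => ab; [have := ranges_lipschitz lw ab | have := ranges_lipschitz lw (ltW ab)]; lia.
Qed.

(* The two increments of the index are each u or u - p: if they differ, their absolute
   values add up to p, and otherwise their sum is the increment over two steps. *)
Lemma bounded_diff2_spread p m w : coprime p m -> (1 < p)%N -> (1 < m)%N ->
  bounded 1 (diff 1 w) -> bounded p (diff 1 (diff 1 (spread p m w))).
Proof.
move=> c p1 m1 lw n; have [u [r [up um]]] := inverse_mod c p1.
have m0 := ltnW m1; have p0 := ltnW p1.
rewrite /diff /spread; have s1 := idx_step n c m0 up um.
have s2 := idx_step (n - 1) c m0 up um.
have [_ Hi] := idxP n c p0 m0; have [_ Hj] := idxP (n - 1 - 1) c p0 m0.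
move: s1 s2 Hi Hj; set a := idx p m n; set b := idx p m (n - 1); set d := idx p m (n - 1 - 1).
move=> s1 s2 Hi Hj.
(* Both remainders lie in [0, m * p), so m * (a - d) < m * p + 2, and m >= 2 gives a - d <= p. *)
have ad : `|a - d| <= p%:Z by move: Hi Hj; rewrite PoszM; nia.
have := bounded_lipschitz a b lw; have := bounded_lipschitz b d lw; lia.
Qed.

Lemma psum_up m c : (0 < m)%N -> causal c -> psum (up m (diff 1 c)) = spread 1 m c.
Proof.
move=> m0 cc; apply: psum_spec; first by apply: causal_spread; rewrite ?coprime1n.
by rewrite diff_spread ?coprime1n.
Qed.

(** The factor 1 - x^p of the window cancels the denominator of [spread]: a window over the letter
    Phi_pq costs one factor p, not two. *)
Lemma window_spread p m c : coprime p m -> (0 < p)%N -> (0 < m)%N -> causal c ->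
  diff p (psum (diff 1 (spread p m (psum c)))) = up m (diff p (psum c)).
Proof.
move=> cp p0 m0 cc; rewrite psum_diff; last exact: causal_spread.
by rewrite diff_spread.
Qed.

(** * The action of a letter on coefficients *)

(* A letter (s, t) stands for Phi_q^s * Phi_(p*q)^t, or for Phi_1^s * Phi_p^t if it comes first. *)
Definition layer_seq (p q : nat) (X : bool * bool) (c : int -> int) : int -> int :=
  match X with
  | (false, false) => up q c
  | (true, false) => spread 1 q c
  | (true, true) => spread p q c
  | (false, true) => diff 1 (spread p q (psum c))
  end.

(** Phi_1 enters as 1 - x rather than x - 1; [coefz_base] accounts for the sign. *)
Definition base_seq (p : nat) (X : bool * bool) (c : int -> int) : int -> int :=
  match X with
  | (false, false) => c
  | (true, false) => diff 1 c
  | (true, true) => diff p c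
  | (false, true) => diff p (psum c)
  end.

Lemma causal_layer p q X c : coprime p q -> (0 < p)%N -> (0 < q)%N ->
  causal c -> causal (layer_seq p q X c).
Proof.
move=> cpq p0 q0 cc; case: X => -[] []; rewrite /layer_seq.
- exact: causal_spread.
- by apply: causal_spread; rewrite ?coprime1n.
- by apply: causal_diff; apply: causal_spread.
- exact: causal_up.
Qed.

Lemma bounded_layer M p q X c : X <> (false, true) -> bounded M c -> bounded M (layer_seq p q X c).
Proof.
by case: X => -[] [] //= _ bc; [apply: bounded_spread..| apply: bounded_up].
Qed.

Lemma ranges_layer a b p q X c : X <> (false, true) -> a <= 0 -> 0 <= b ->
  ranges a b c -> ranges a b (layer_seq p q X c).
Proof.
by case: X => -[] [] //= _ a0 b0 bc; [apply: ranges_spread..| apply: ranges_up].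
Qed.

Lemma pulse01 : ranges 0 1 pulse.
Proof. by move=> n; rewrite /pulse; case: eqP. Qed.

Lemma psum_pulse : psum pulse = fun n => (0 <= n)%R%:Z.
Proof.
apply: psum_spec; first by move=> n n0; case: leP => //; lia.
by apply: funext => n; rewrite /diff /pulse; case: eqP => [->|] //; case: leP; case: leP; lia.
Qed.

(** The partial sums of the series 1 form a step function with values 0 and 1, and spreading keeps
    these values, so their differences are at most 1 in absolute value. This is the classical
    flatness of Phi_pq. *)
Lemma layer_cyclotomic_flat p q : coprime p q -> (0 < p)%N -> (0 < q)%N ->
  bounded 1 (layer_seq p q (false, true) pulse).
Proof.
move=> c p0 q0; rewrite /= psum_pulse; apply: (@bounded_diff 0 1) => //.
by apply: ranges_spread => n; case: (0 <= n).
Qed.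

Lemma up_pulse m : (0 < m)%N -> up m pulse = pulse.
Proof.
move=> m0; apply: funext => n; rewrite /up /pulse; case: ifP => [/dvdzP[d ->]|H].
  by rewrite mulzK ?mulf_eq0; [case: eqP => //=; lia| lia].
by case: eqP => // n0; move: H; rewrite n0 dvdz0.
Qed.

Lemma psum_diff_up_pulse p q : (0 < p)%N -> (0 < q)%N ->
  ranges 0 1 (psum (up q (diff p pulse))).
Proof.
move=> p0 q0; suff -> : psum (up q (diff p pulse)) = fun n => (0 <= n < (q * p)%N%:Z)%R%:Z.
  by move=> n; lia.
apply: psum_spec; first by move=> n n0; case: leP => //; lia.
have qp : (0 < q * p)%N by rewrite muln_gt0 q0.
rewrite up_diff //; apply: funext => n; rewrite /diff.
rewrite up_pulse // /pulse; move: (q * p)%N qp => N N0; lia.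
Qed.

(* Flatness comes from w (i + p) <= w i + 1 for the partial sums w of the inner layer. *)
Lemma layer_mixed_flat p q : coprime p q -> (1 < p)%N -> (0 < q)%N ->
  bounded 1 (layer_seq p q (false, true) (layer_seq p q (true, true) pulse)).
Proof.
move=> c p1 q0; have p0 := ltnW p1; rewrite /=.
set w := psum _.
have cs : causal (spread p q pulse) by apply: causal_spread.
have w1 : ranges 0 1 (diff 1 w).
  by rewrite diff_psum //; apply: ranges_spread pulse01.
have wp : ranges 0 1 (diff p w).
  by rewrite diff_psumC // diff_spread //; apply: psum_diff_up_pulse.
have wij i j : j <= i <= j + p%:Z -> 0 <= w i - w j <= 1.
  move=> /andP[ji ij]; have /andP[-> _] /= := ranges_lipschitz w1 ji.
  have := ranges_lipschitz w1 ij; have := wp (j + p%:Z); rewrite /diff addrK.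
  lia.
have [u [r [up um]]] := inverse_mod c p1.
move=> n; rewrite /diff /spread; have := idx_step n c q0 up um.
move: (idx _ _ _) (idx _ _ _) => i j ij.
case: (leP j i) => ji; first by have := wij i j; lia.
by have := wij j i; lia.
Qed.

(** The partial sums of the outer letter undo the difference of the inner one, and the two index
    functions compose. *)
Lemma layer_double p q c : coprime p q -> (0 < p)%N -> (0 < q)%N -> causal c ->
  layer_seq p q (false, true) (layer_seq p q (false, true) c) =
  layer_seq p (q * q) (false, true) c.
Proof.
move=> cpq p0 q0 cc; rewrite /= psum_diff; last exact: causal_spread.
by rewrite spread_comp.
Qed.

(** If Y is not Phi_pq alone, the tail stays flat and the base letter costs at most a window of
    length p. If it is, a factor 1 - x^p of the base letter cancels the denominator of Y, leaving an
    interleaved window; without that factor at most two differences of [spread] remain, still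
    bounded by p. *)
Lemma bounded_base_layer_flat p q X Y c : coprime p q -> (2 < p)%N -> (2 < q)%N ->
  causal c -> bounded 1 c -> bounded p (base_seq p X (layer_seq p q Y c)).
Proof.
move=> cpq p2 q2 cc bc.
have [p1 q1] : (1 < p)%N /\ (1 < q)%N by split; lia.
have [p0 q0] : (0 < p)%N /\ (0 < q)%N by split; lia.
have cl := causal_layer Y cpq p0 q0 cc.
have [->|/eqP nY] := eqVneq Y (false, true); last first.
  have bl : bounded 1 (layer_seq p q Y c) by apply: bounded_layer.
  case: X => -[] []; rewrite /base_seq; try exact: bounded_diff1.
    exact: bounded_window1.
  by apply: bounded_leq bl.
have bs : bounded 1 (diff 1 (psum c)) by rewrite diff_psum.
case: X => -[] []; rewrite /base_seq /=.
- rewrite diffC diff_spread //; apply: bounded_diff_up; first by rewrite dvdn1; lia.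
  exact: bounded_window1.
- exact: bounded_diff2_spread.
- rewrite window_spread //; apply: bounded_up.
  exact: bounded_window1.
- exact: bounded_diff_spread.
Qed.

(** [spread 1 q pulse] is 1 + x + ... + x^(q-1). The slope 1 of the ramp of its partial sums is what
    makes the Lipschitz bounds sharp for the exceptional word. *)
Lemma psum_block q n : (0 < q)%N ->
  psum (spread 1 q pulse) n = if n < 0 then 0 else if n < q%:Z then n + 1 else q%:Z.
Proof.
move=> q0; have c1 := coprime1n q.
rewrite (@psum_spec (fun n => if n < 0 then 0 else if n < q%:Z then n + 1 else q%:Z)) //.
  by move=> i i0; rewrite i0.
apply: (@diff_inj 1) => //; first by apply: causal_diff => i i0; rewrite i0.
  exact: causal_spread.
rewrite diff_spread // up_diff // muln1; apply: funext => i; rewrite /diff.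
rewrite up_pulse // /pulse.
by case: (ltP i 0); case: (ltP (i - 1) 0); case: (ltP (i - 1 - 1) 0);
  case: (ltP i q%:Z); case: (ltP (i - 1) q%:Z); case: (ltP (i - 1 - 1) q%:Z); lia.
Qed.

Lemma psum_block_ranges q : (0 < q)%N -> ranges 0 q%:Z (psum (spread 1 q pulse)).
Proof. by move=> q0 n; rewrite psum_block //; case: ltP => ?; [|case: ltP => ?]; lia. Qed.

Lemma layer_block_ranges p q u r : coprime p q -> (0 < p)%N -> (0 < q)%N ->
  (0 < u < p)%N -> (u * q = p * r + 1)%N ->
  ranges (u%:Z - p%:Z) u%:Z (layer_seq p q (false, true) (layer_seq p q (true, false) pulse)).
Proof.
move=> c p0 q0 up uq; apply: (ranges_diff_spread c q0 up uq) => /=.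
rewrite diff_psum; first exact: ranges_spread pulse01.
by apply: causal_spread; rewrite ?coprime1n.
Qed.

(** This tail is not flat, but its range has width p. If Y is Phi_pq, it merges with the next letter
    by [layer_double]. Otherwise Y preserves the range, so a base letter with Phi_1 is a difference
    costing p, and the trivial base letter is immediate. The base letter Phi_p needs a cancellation
    for each remaining Y. *)
Lemma bounded_base_layer_block p q X Y : coprime p q -> (2 < p)%N -> (2 < q)%N ->
  ~~ (q %| p)%N -> (X, Y) <> ((false, true), (true, false)) ->
  bounded p (base_seq p X (layer_seq p q Y
    (layer_seq p q (false, true) (layer_seq p q (true, false) pulse)))).
Proof.
move=> cpq p2 q2 qp nXY.
have [p1 q1] : (1 < p)%N /\ (1 < q)%N by split; lia.
have [p0 q0] : (0 < p)%N /\ (0 < q)%N by split; lia.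
have cpqq : coprime p (q * q) by rewrite coprimeMr cpq.
have qq1 : (1 < q * q)%N by nia.
have [u [r [u_p uq]]] := inverse_mod cpq p1.
have rc := layer_block_ranges cpq p0 q0 u_p uq.
have bE : bounded 1 (layer_seq p q (true, false) pulse).
  by apply: (bounded_ranges (ranges_layer p q _ _ _ pulse01)).
have cE : causal (layer_seq p q (true, false) pulse) by apply: causal_layer.
have cT := causal_layer (false, true) cpq p0 q0 cE.
have bw : bounded 1 (diff 1 (psum (layer_seq p q (true, false) pulse))).
  by rewrite diff_psum.
have bW := bounded_window1 p cE bE.
have bT : bounded p (layer_seq p q (false, true) (layer_seq p q (true, false) pulse)).
  by apply: (bounded_ranges rc); lia.
have [YE|/eqP nY] := eqVneq Y (false, true).
  rewrite YE layer_double //.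
  move: (layer_seq p q (true, false) pulse) cE bw bW {rc bE cT bT nXY} => e cE bw bW.
  case: X => -[] []; rewrite /base_seq /=.
  - rewrite diffC diff_spread //; last lia.
    by apply: bounded_diff_up => //; rewrite dvdn1; lia.
  - exact: bounded_diff2_spread.
  - by rewrite window_spread //; [apply: bounded_up | lia].
  - by apply: bounded_diff_spread => //; lia.
have dl k : bounded p (diff k (layer_seq p q Y
    (layer_seq p q (false, true) (layer_seq p q (true, false) pulse)))).
  by apply: (bounded_diff _ (ranges_layer p q _ _ _ rc)) => //; lia.
case: X nXY => -[] []; rewrite /base_seq => nXY.
- exact: dl.
- exact: dl.
- case: Y nXY nY {dl} => -[] [] // nXY nY; last first.
    rewrite diff_psumC; last exact: causal_up.
    set e := layer_seq p q (true, false) pulse in cE bw bW cT bT *.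
    have -> : layer_seq p q (false, false) (layer_seq p q (false, true) e) =
              up q (diff 1 (spread p q (psum e))) by [].
    rewrite -diff_psumC; last by apply: causal_up; apply: causal_diff; apply: causal_spread.
    rewrite psum_up //; last exact: causal_spread.
    (* What remains is a difference of two ramp values, all in [0, q]; this suffices if q < p. If p
       <= q, the quotients of n and n - p by q are equal or consecutive, and the difference is 0 or
       a coefficient of the tail. *)
    case: (ltnP q p) => qp'.
      apply: (@bounded_diff 0 q) => [|]; last lia.
      by do 2!apply: ranges_spread; apply: psum_block_ranges.
    move=> n; rewrite /diff {1 3}/spread.
    have [_ Hi] := idxP n (coprime1n q) isT q0.
    have [_ Hj] := idxP (n - p%:Z) (coprime1n q) isT q0.
    move: (idx 1 q n) (idx 1 q (n - p%:Z)) Hi Hj => i j Hi Hj.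
    have : i = j \/ j = i - 1 by rewrite muln1 in Hi Hj; nia.
    by case=> ->; [rewrite subrr normr0; lia | exact: bT].
  set e := layer_seq p q (true, false) pulse in cE bw bW cT bT *.
  have -> : layer_seq p q (true, true) (layer_seq p q (false, true) e) =
            spread p q (diff 1 (spread p q (psum e))) by [].
  set t := diff 1 _; have ct : causal t by exact: cT.
  (* After 1 - x^p cancels the denominator, dividing by 1 - x merely repeats the window sums of
     t. *)
  have -> : diff p (psum (spread p q t)) = spread 1 q (diff p (psum t)).
    rewrite diff_psumC; last exact: causal_spread.
    rewrite diff_spread // -psum_up //; last by apply: causal_diff.
    by rewrite diffC diff_psum.
  by apply: bounded_spread; rewrite /t window_spread //; apply: bounded_up.
- by apply: bounded_layer.
Qed.

(** The last two letters form a flat tail unless they are Phi_pq followed by Phi_q, which is the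
    case of [bounded_base_layer_block]. *)
Lemma bounded_word p q X0 X1 X2 X3 : coprime p q -> (2 < p)%N -> (2 < q)%N ->
  ~~ (q %| p)%N ->
  [:: X0; X1; X2; X3] <> [:: (false, true); (true, false); (false, true); (true, false)] ->
  bounded p (base_seq p X0 (layer_seq p q X1 (layer_seq p q X2 (layer_seq p q X3 pulse)))).
Proof.
move=> cpq p2 q2 qp nw.
have [p1 q1] : (1 < p)%N /\ (1 < q)%N by split; lia.
have [p0 q0] : (0 < p)%N /\ (0 < q)%N by split; lia.
have [e23|/eqP n23] := eqVneq (X2, X3) ((false, true), (true, false)).
  case: e23 nw => -> -> nw; apply: bounded_base_layer_block => // -[e0 e1].
  by apply: nw; rewrite e0 e1.
have bp : bounded 1 pulse by apply: (bounded_ranges pulse01).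
apply: bounded_base_layer_flat => //; first by do 2!apply: causal_layer => //.
have flat1 X : bounded 1 (layer_seq p q X pulse).
  have [->|/eqP nX] := eqVneq X (false, true); first exact: layer_cyclotomic_flat.
  exact: bounded_layer.
have [e2|/eqP n2] := eqVneq X2 (false, true); last by apply: bounded_layer.
move: n23; rewrite {}e2; case: X3 {nw} => -[] [] // _.
- exact: layer_mixed_flat.
- rewrite layer_double //; apply: layer_cyclotomic_flat => //; last by rewrite muln_gt0 q0.
  by rewrite coprimeMr cpq.
- apply: (@bounded_diff 0 1) => //; apply: ranges_spread => n.
  rewrite /= -[up q pulse](_ : up q (diff 1 (psum pulse)) = _); last by rewrite diff_psum.
  by rewrite psum_up // psum_pulse; rewrite /spread; lia.
Qed.

(** * Cyclotomic polynomials as words *)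

Lemma prod_Cyclotomic_pfactor q k : prime q ->
  \prod_(j < k.+1) 'Phi_(q ^ j) = 'X^(q ^ k) - 1.
Proof.
move=> pq; rewrite -prod_Cyclotomic ?expn_gt0 ?prime_gt0 //.
rewrite -(big_mkord xpredT (fun j => 'Phi_(q ^ j))) -(big_map (expn q) xpredT (fun d => 'Phi_d)).
apply: perm_big; apply: uniq_perm; rewrite ?divisors_uniq //.
  rewrite map_inj_uniq ?iota_uniq // => i j /eqP.
  by rewrite eqn_exp2l ?prime_gt1 // => /eqP.
move=> d; rewrite -dvdn_divisors ?expn_gt0 ?prime_gt0 //; apply/mapP/(dvdn_pfactor _ _ pq).
  by case=> j; rewrite mem_index_iota => jk ->; exists j.
by case=> j jk ->; exists j; rewrite ?mem_index_iota.
Qed.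

Lemma prod_Cyclotomic_prime_pfactor p q k : prime p -> prime q -> p != q ->
  \prod_(j < k.+1) ('Phi_(q ^ j) * 'Phi_(p * q ^ j)) = 'X^(p * q ^ k) - 1.
Proof.
move=> pp pq npq; have p0 := prime_gt0 pp; have q0 := prime_gt0 pq.
have cp j : coprime p (q ^ j) by rewrite coprimeXr // prime_coprime // dvdn_prime2.
have npd j : (p %| q ^ j)%N = false by apply/negbTE; rewrite -prime_coprime.
rewrite -prod_Cyclotomic ?muln_gt0 ?expn_gt0 ?p0 ?q0 // big_split /=.
rewrite -(big_mkord xpredT (fun j => 'Phi_(q ^ j))) -(big_mkord xpredT (fun j => 'Phi_(p * q ^ j))).
rewrite -(big_map (expn q) xpredT (fun d => 'Phi_d)).
rewrite -(big_map (fun j => p * q ^ j)%N xpredT (fun d => 'Phi_d)) -big_cat.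
have qinj : injective (expn q).
  by move=> i j /eqP; rewrite eqn_exp2l ?prime_gt1 // => /eqP.
apply: perm_big; apply: uniq_perm; rewrite ?divisors_uniq //.
  rewrite cat_uniq !map_inj_uniq ?iota_uniq //; last first.
    by move=> i j /eqP; rewrite eqn_pmul2l // => /eqP/qinj.
  rewrite andTb andbT; apply/hasPn => d /mapP[j _ ->]; apply/negP => /mapP[i _ E].
  by have := npd i; rewrite -E dvdn_mulr.
move=> d; rewrite -dvdn_divisors ?muln_gt0 ?expn_gt0 ?p0 ?q0 // mem_cat.
apply/orP/idP.
  case=> /mapP[j]; rewrite mem_index_iota => jk ->.
    by rewrite dvdn_mull // dvdn_exp2l.
  by rewrite dvdn_pmul2l // dvdn_exp2l.
have [/dvdnP[e ->]|npd'] := boolP (p %| d)%N.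
  rewrite mulnC dvdn_pmul2l // => /(dvdn_pfactor _ _ pq)[j jk ->].
  by right; apply/mapP; exists j; rewrite ?mem_index_iota.
rewrite Gauss_dvdr; last by rewrite coprime_sym prime_coprime.
move=> /(dvdn_pfactor _ _ pq)[j jk ->].
by left; apply/mapP; exists j; rewrite ?mem_index_iota.
Qed.

Lemma Xn_sub1_neq0 (R : nzRingType) n : (0 < n)%N -> 'X^n - 1 != 0 :> {poly R}.
Proof. by move=> n0; apply/monic_neq0; rewrite -polyC1; apply: monicXnsubC. Qed.

Lemma Cyclotomic_pfactor_mul q k : prime q ->
  'Phi_(q ^ k.+1) * ('X^(q ^ k) - 1) = 'X^(q ^ k.+1) - 1.
Proof. by move=> pq; rewrite -!prod_Cyclotomic_pfactor // [RHS]big_ord_recr mulrC. Qed.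

Lemma Cyclotomic_prime_pfactor_mul p q k : prime p -> prime q -> p != q ->
  'Phi_(q ^ k.+1) * 'Phi_(p * q ^ k.+1) * ('X^(p * q ^ k) - 1) = 'X^(p * q ^ k.+1) - 1.
Proof. by move=> pp pq npq; rewrite -!prod_Cyclotomic_prime_pfactor // [RHS]big_ord_recr mulrC. Qed.

Lemma comp_Xn_sub1 m n : ('X^n - 1) \Po 'X^m = 'X^(m * n) - 1 :> {poly int}.
Proof. by rewrite comp_polyB comp_Xn_poly -exprM -polyC1 comp_polyC. Qed.

Lemma Cyclotomic1 : 'Phi_1 = 'X - 1.
Proof. by have := prod_Cyclotomic (ltn0Sn 0); rewrite /divisors /= big_seq1 expr1. Qed.

Lemma Cyclotomic_prime_mul q : prime q -> 'Phi_q * ('X - 1) = 'X^q - 1.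
Proof. by move=> pq; have := Cyclotomic_pfactor_mul 0 pq; rewrite expn1 expr1. Qed.

Lemma Cyclotomic_prime2_mul p q : prime p -> prime q -> p != q ->
  'Phi_q * 'Phi_(p * q) * ('X^p - 1) = 'X^(p * q) - 1.
Proof.
by move=> pp pq npq; have := Cyclotomic_prime_pfactor_mul 0 pp pq npq; rewrite expn1 expn0 muln1.
Qed.

(** Both sides become x^(q^(k+1)) - 1 after multiplication by x^(q^k) - 1. *)
Lemma Cyclotomic_pfactor_comp q k : prime q -> 'Phi_(q ^ k.+1) = 'Phi_q \Po 'X^(q ^ k).
Proof.
move=> pq; have q0 : (0 < q ^ k)%N by rewrite expn_gt0 prime_gt0.
apply: (mulIf (Xn_sub1_neq0 _ q0)); rewrite Cyclotomic_pfactor_mul // expnSr -comp_Xn_sub1.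
rewrite -Cyclotomic_prime_mul // comp_polyM; congr (_ * _).
by rewrite -['X - 1]/('X^1 - 1) comp_Xn_sub1 muln1.
Qed.

Lemma Cyclotomic_prime_pfactor_comp p q k : prime p -> prime q -> p != q ->
  'Phi_(p * q ^ k.+1) = 'Phi_(p * q) \Po 'X^(q ^ k).
Proof.
move=> pp pq npq; have p0 := prime_gt0 pp; have q0 := prime_gt0 pq.
have qk0 : (0 < p * q ^ k)%N by rewrite muln_gt0 expn_gt0 p0 q0.
apply: (mulfI (monic_neq0 (Cyclotomic_monic (q ^ k.+1)))).
apply: (mulIf (Xn_sub1_neq0 _ qk0)); rewrite Cyclotomic_prime_pfactor_mul //.
rewrite (Cyclotomic_pfactor_comp k pq) expnSr mulnA [(p * q ^ k)%N]mulnC -mulnA.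
rewrite -(comp_Xn_sub1 _ (p * q)) -(comp_Xn_sub1 _ p).
by rewrite -Cyclotomic_prime2_mul // !comp_polyM.
Qed.

(** * From polynomials to coefficient sequences *)

Definition coefz (f : {poly int}) (n : int) : int := if n is Posz m then f`_m else 0.

Lemma causal_coefz f : causal (coefz f).
Proof. by case. Qed.

Lemma coefzN f n : coefz (- f) n = - coefz f n.
Proof. by case: n => n /=; rewrite ?coefN ?oppr0. Qed.

Lemma coefz_1subXn k f : coefz ((1 - 'X^k) * f) = diff k (coefz f).
Proof.
apply: funext => -[n|n]; rewrite /diff; last by rewrite ?causal_coefz //; lia.
rewrite mulrBl mul1r [in LHS]/coefz coefB coefXnM; congr (_ - _).
case: ltnP => nk; first by rewrite causal_coefz //; lia.
by have -> : n%:Z - k%:Z = (n - k)%N%:Z by lia.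
Qed.

Lemma coefz_comp m f : (0 < m)%N -> coefz (f \Po 'X^m) = up m (coefz f).
Proof.
move=> m0; apply: funext => -[n|n]; last first.
  by rewrite causal_up //; apply: causal_coefz.
by rewrite /up /= coef_comp_poly_Xn // /dvdz /= divz_nat.
Qed.

Lemma coefz_one : coefz 1 = pulse.
Proof. by apply: funext => -[n|n] //=; rewrite coef1 /pulse; case: n. Qed.

Definition base_poly (p : nat) (X : bool * bool) : {poly int} :=
  'Phi_1 ^+ X.1 * 'Phi_p ^+ X.2.

Definition layer_poly (p q : nat) (X : bool * bool) : {poly int} :=
  'Phi_q ^+ X.1 * 'Phi_(p * q) ^+ X.2.

Lemma coefz_layer p q X f : prime p -> prime q -> p != q ->
  coefz (layer_poly p q X * (f \Po 'X^q)) = layer_seq p q X (coefz f).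
Proof.
move=> pp pq npq; have p0 := prime_gt0 pp; have q0 := prime_gt0 pq.
have cpq : coprime p q by rewrite prime_coprime // dvdn_prime2.
have cf := @causal_coefz.
have diff_up g : diff q (up q g) = up q (diff 1 g) by rewrite up_diff // muln1.
have E1 : (1 - 'X^1) * 'Phi_q = 1 - 'X^q.
  by rewrite -opprB mulNr mulrC expr1 Cyclotomic_prime_mul // opprB.
have E2 : (1 - 'X^p) * ('Phi_q * 'Phi_(p * q)) = 1 - 'X^(p * q).
  by rewrite -opprB mulNr mulrC Cyclotomic_prime2_mul // opprB.
case: X => -[] []; rewrite /layer_poly /= ?expr1 ?expr0 ?mul1r ?mulr1.
- apply: (@diff_inj p) => //; first exact: causal_spread.
  by rewrite diff_spread // -coefz_1subXn mulrA E2 coefz_1subXn coefz_comp // mulnC -up_diff.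
- apply: (@diff_inj 1) => //; first by apply: causal_spread; rewrite ?coprime1n.
  rewrite diff_spread ?coprime1n // -coefz_1subXn mulrA E1 coefz_1subXn coefz_comp //.
- have cs : causal (diff 1 (spread p q (psum (coefz f)))).
    by apply: causal_diff; apply: causal_spread.
  (* Phi_pq is (1 - x)(1 - x^(pq)) / ((1 - x^p)(1 - x^q)), so two denominators are cleared. *)
  apply: (@diff_inj p) => //; apply: (@diff_inj q) => //; do ?[exact: causal_diff].
  have -> : diff q (diff p (coefz ('Phi_(p * q) * (f \Po 'X^q)))) =
            diff 1 (diff (p * q) (up q (coefz f))).
    rewrite -coefz_comp // -!coefz_1subXn -E1 -E2; congr coefz.
    move: ('Phi_q) ('Phi_(p * q)) => a b; ring.
  rewrite [in RHS](diffC p) diff_spread // [RHS]diffC; congr (diff 1 _).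
  by rewrite diff_up diffC diff_psum // mulnC -up_diff.
- exact: coefz_comp.
Qed.

Lemma coefz_base p (X : bool * bool) f : prime p ->
  coefz ((-1) ^+ X.1 * base_poly p X * f) = base_seq p X (coefz f).
Proof.
move=> pp; have p0 := prime_gt0 pp; have cf := @causal_coefz.
have EN : -1 * 'Phi_1 = 1 - 'X^1 by rewrite Cyclotomic1 mulN1r opprB expr1.
case: X => -[] []; rewrite /base_poly /= ?expr1 ?expr0 ?mul1r ?mulr1.
- rewrite mulrA EN -coefz_1subXn; congr (coefz (_ * _)).
  by rewrite -opprB mulNr mulrC expr1 Cyclotomic_prime_mul // opprB.
- by rewrite EN coefz_1subXn.
- apply: (@diff_inj 1) => //; first exact: causal_diff.
  rewrite diffC diff_psum // -!coefz_1subXn mulrA; congr (coefz (_ * _)).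
  by rewrite -opprB mulNr mulrC expr1 Cyclotomic_prime_mul // opprB.
- by [].
Qed.

Definition word_poly (p q : nat) (X0 X1 X2 X3 : bool * bool) : {poly int} :=
  'Phi_1 ^+ X0.1 * 'Phi_p ^+ X0.2 * ('Phi_q ^+ X1.1 * 'Phi_(p * q) ^+ X1.2) *
  ('Phi_(q ^ 2) ^+ X2.1 * 'Phi_(p * q ^ 2) ^+ X2.2) *
  ('Phi_(q ^ 3) ^+ X3.1 * 'Phi_(p * q ^ 3) ^+ X3.2).

(** Since the letters at q^2 and q^3 are substitutions of x^q and x^(q^2), the word nests as in
    Horner's scheme, each letter multiplying a tail evaluated at x^q. *)
Lemma coefz_word p q (X0 X1 X2 X3 : bool * bool) : prime p -> prime q -> p != q ->
  coefz ((-1) ^+ X0.1 * word_poly p q X0 X1 X2 X3) =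
  base_seq p X0 (layer_seq p q X1 (layer_seq p q X2 (layer_seq p q X3 pulse))).
Proof.
move=> pp pq npq.
rewrite -coefz_one -!coefz_layer // -coefz_base //; congr coefz.
rewrite /word_poly /layer_poly !(Cyclotomic_pfactor_comp _ pq) !Cyclotomic_prime_pfactor_comp //.
rewrite !comp_polyM !rmorphXn /= -!comp_polyA !comp_Xn_poly -!exprM expn1 -mulnn comp_polyC mulr1.
by rewrite /base_poly !mulrA.
Qed.

Lemma polyheightP f M : reflect (bounded M (coefz f)) (polyheight f <= M)%N.
Proof.
apply: (iffP (bigmax_leqP _ _ _)) => [H [n|n]|H i _] /=; rewrite ?normr0 //.
  case: (ltnP n (size f)) => nf; first by have := H (Ordinal nf) isT; rewrite -lez_nat abszE.
  by rewrite nth_default // normr0.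
by have := H (Posz i); rewrite -lez_nat abszE.
Qed.

Lemma le_polyheight f n : `|coefz f n| <= (polyheight f)%:Z.
Proof. exact/polyheightP. Qed.

Lemma polyheight_sign (b : bool) f : polyheight ((-1) ^+ b * f) = polyheight f.
Proof.
have H g : (polyheight (- g) <= polyheight g)%N.
  by apply/polyheightP => n; rewrite coefzN normrN le_polyheight.
case: b; rewrite ?expr1 ?expr0 ?mul1r // mulN1r; apply/eqP; rewrite eqn_leq H.
by have := H (- f); rewrite opprK => ->.
Qed.

(** * The bounds by powers of q *)

(** Without Phi_q, a letter acts on partial sums by a mere [spread], so the range [0, 1] persists
    through any number of letters. *)
Lemma ranges_psum_layer p q t c : coprime p q -> (0 < p)%N -> (0 < q)%N -> causal c ->
  ranges 0 1 (psum c) -> ranges 0 1 (psum (layer_seq p q (false, t) c)).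
Proof.
move=> cpq p0 q0 cc rc; case: t => /=.
  by rewrite psum_diff; [apply: ranges_spread | apply: causal_spread].
by rewrite -(diff_psum cc) psum_up //; apply: ranges_spread.
Qed.

Lemma bounded_base_false p t c : causal c -> ranges 0 1 (psum c) ->
  bounded 1 (base_seq p (false, t) c).
Proof.
move=> cc rc; case: t => /=; first exact: (bounded_diff _ rc).
by rewrite -(diff_psum cc); apply: (bounded_diff _ rc).
Qed.

Lemma polyheight_word_flat p q t0 t1 t2 t3 : prime p -> prime q -> p != q ->
  (polyheight (word_poly p q (false, t0) (false, t1) (false, t2) (false, t3)) <= 1)%N.
Proof.
move=> pp pq npq; have p0 := prime_gt0 pp; have q0 := prime_gt0 pq.
have cpq : coprime p q by rewrite prime_coprime // dvdn_prime2.
rewrite -(polyheight_sign false); apply/polyheightP.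
rewrite (@coefz_word p q (false, t0)) //; apply: bounded_base_false.
  by do 3!apply: causal_layer => //.
do 2!(apply: ranges_psum_layer => //; first by do ?apply: causal_layer => //).
apply: ranges_psum_layer => //.
by rewrite psum_pulse => n; lia.
Qed.

Lemma polyheightD f g : (polyheight (f + g) <= polyheight f + polyheight g)%N.
Proof.
apply/polyheightP => n; rewrite PoszD; case: n => n /=; rewrite ?normr0 // coefD.
by apply: le_trans (ler_normD _ _) _; apply: lerD; apply: (le_polyheight _ (Posz n)).
Qed.

Lemma polyheight_MXn f k : (polyheight (f * 'X^k) <= polyheight f)%N.
Proof.
apply/polyheightP => -[n|n] /=; rewrite ?normr0 // coefMXn; case: ifP => _.
  by rewrite normr0.
exact: (le_polyheight _ (Posz _)).
Qed.

Lemma Cyclotomic_prime_sum q : prime q -> 'Phi_q = \sum_(i < q) 'X^i.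
Proof.
move=> pq; apply: (mulIf (Xn_sub1_neq0 _ (ltn0Sn 0))).
by rewrite expr1 Cyclotomic_prime_mul // [RHS]mulrC -subrX1.
Qed.

(** The product is a sum of q shifted copies of f. *)
Lemma polyheight_MCyclotomic f q k : prime q ->
  (polyheight (f * 'Phi_(q ^ k.+1)) <= q * polyheight f)%N.
Proof.
move=> pq; rewrite Cyclotomic_pfactor_comp // Cyclotomic_prime_sum // rmorph_sum mulr_sumr /=.
suff H m : (polyheight (\sum_(i < m) f * ('X^i \Po 'X^(q ^ k))) <= m * polyheight f)%N by apply: H.
elim: m => [|m IH].
  by rewrite big_ord0; apply/polyheightP => -[n|n] /=; rewrite ?coef0.
rewrite big_ord_recr /= mulSn addnC; apply: leq_trans (polyheightD _ _) _; apply: leq_add => //.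
by rewrite comp_Xn_poly -exprM; apply: polyheight_MXn.
Qed.

Lemma polyheight_MCyclotomic1 f : (polyheight (f * 'Phi_1) <= 2 * polyheight f)%N.
Proof.
rewrite Cyclotomic1 mulrBr mulr1; apply: leq_trans (polyheightD _ _) _.
rewrite mul2n -addnn leq_add //; first by have := polyheight_MXn f 1; rewrite expr1.
by rewrite -[X in (_ <= X)%N](polyheight_sign true) expr1 mulN1r.
Qed.

Lemma polyheight_word p q (X0 X1 X2 X3 : bool * bool) : prime p -> prime q -> p != q ->
  (polyheight (word_poly p q X0 X1 X2 X3) <= 2 ^ X0.1 * q ^ (X1.1 + X2.1 + X3.1))%N.
Proof.
move=> pp pq npq; case: X0 X1 X2 X3 => [s0 t0] [s1 t1] [s2 t2] [s3 t3] /=.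
set f := word_poly p q (false, t0) (false, t1) (false, t2) (false, t3).
have f1 : (polyheight f <= 1)%N by apply: polyheight_word_flat.
have stepq k (s : bool) (g : {poly int}) N : (polyheight g <= N)%N ->
    (polyheight (g * 'Phi_(q ^ k.+1) ^+ s) <= N * q ^ s)%N.
  case: s => gN; last by rewrite expr0 expn0 mulr1 muln1.
  rewrite expr1 expn1 mulnC; apply: leq_trans (polyheight_MCyclotomic _ _ pq) _.
  by rewrite leq_mul2l gN orbT.
have -> : word_poly p q (s0, t0) (s1, t1) (s2, t2) (s3, t3) =
    f * 'Phi_1 ^+ s0 * 'Phi_(q ^ 1) ^+ s1 * 'Phi_(q ^ 2) ^+ s2 * 'Phi_(q ^ 3) ^+ s3.
  rewrite /f /word_poly /= !expr0 !mul1r expn1.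
  by move: ('Phi_1 ^+ _) ('Phi_p ^+ _) ('Phi_q ^+ _) ('Phi_(p * q) ^+ _) ('Phi_(q ^ 2) ^+ _)
    ('Phi_(p * q ^ 2) ^+ _) ('Phi_(q ^ 3) ^+ _) ('Phi_(p * q ^ 3) ^+ _) => *; ring.
rewrite !expnD !mulnA; do 3!apply: (stepq _ _ _ _).
case: s0; last by rewrite expr0 mulr1.
by rewrite expr1 expn1; apply: leq_trans (polyheight_MCyclotomic1 _) _; lia.
Qed.

(** Only the factor 2 from Phi_1 is in the way. If some Phi_(q^j) with 1 <= j <= 3 is missing, 2 *
    q^2 <= q^3. If none is, together with Phi_1 they multiply to x^(q^3) - 1, and the height is at
    most 2. *)
Lemma polyheight_word_qcube p q X0 X1 X2 X3 : prime p -> prime q -> p != q -> (2 < q)%N ->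
  (polyheight (word_poly p q X0 X1 X2 X3) <= q ^ 3)%N.
Proof.
move=> pp pq npq q2; have := polyheight_word X0 X1 X2 X3 pp pq npq.
have q0 := prime_gt0 pq; have le2 m n : (m <= n)%N -> (q ^ m <= q ^ n)%N by rewrite leq_exp2l //; lia.
case: X0 X1 X2 X3 => [[] t0] [s1 t1] [s2 t2] [s3 t3] /= H; last first.
  by apply: leq_trans H _; rewrite mul1n le2 //; case: (s1); case: (s2); case: (s3).
have [/and3P[e1 e2 e3]|ns] := boolP [&& s1, s2 & s3]; last first.
  apply: leq_trans H _; rewrite expn1 expnS.
  apply: leq_mul; first by lia.
  by apply: le2; move: ns; case: (s1); case: (s2); case: (s3).
rewrite e1 e2 e3 {H}.
set f := word_poly p q (false, t0) (false, t1) (false, t2) (false, t3).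
have -> : word_poly p q (true, t0) (true, t1) (true, t2) (true, t3) = f * 'X^(q ^ 3) - f.
  rewrite -[X in _ = _ - X]mulr1 -mulrBr -prod_Cyclotomic_pfactor // !big_ord_recr big_ord0 /=.
  rewrite /f /word_poly /= !expr0 !expr1 !mul1r expn1 expn0.
  by move: ('Phi_1) ('Phi_p ^+ _) ('Phi_q) ('Phi_(p * q) ^+ _) ('Phi_(q ^ 2))
    ('Phi_(p * q ^ 2) ^+ _) ('Phi_(q ^ 3)) ('Phi_(p * q ^ 3) ^+ _) => *; ring.
have f1 : (polyheight f <= 1)%N by apply: polyheight_word_flat.
apply: leq_trans (polyheightD _ _) _; apply: leq_trans (_ : 2 <= _)%N.
  rewrite -[2%N]/(1 + 1)%N leq_add //; first exact: leq_trans (polyheight_MXn _ _) f1.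
  by rewrite -(polyheight_sign true) expr1 mulN1r opprK.
by rewrite expnS; have := leq_exp2l 0 2 (ltnW q2); rewrite expn0; nia.
Qed.

(** * The exceptional word *)

Lemma psum_block_lt q n : 0 <= n < q%:Z -> psum (spread 1 q pulse) n = n + 1.
Proof.
move=> /andP[n0 nq]; rewrite psum_block; last by lia.
by rewrite ltNge n0 nq.
Qed.

(** For p <= q, a window ending at the last index of a block of length q stays inside it and sees p
    copies of [c j]. *)
Lemma window_block p q c j : (0 < p <= q)%N -> causal c ->
  diff p (psum (spread 1 q c)) (q%:Z * j + q%:Z - 1) = p%:Z * c j.
Proof.
move=> /andP[p0 pq] cc; have q0 := leq_trans p0 pq.
rewrite windowE; last by apply: causal_spread; rewrite ?coprime1n.
rewrite (eq_bigr (fun=> c j)); first by rewrite sumr_const card_ord -mulr_natl natz.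
move=> i _; rewrite /spread; congr c; apply: idx_uniq; rewrite ?coprime1n //.
split; first by exists (q%:Z * j + q%:Z - 1 - i%:Z - q%:Z * j); rewrite mul1r.
by have := ltn_ord i; rewrite muln1; lia.
Qed.

Lemma layer_block_value p q (i j : int) (a b : nat) : coprime p q -> (0 < p)%N -> (a < q)%N -> (b < q)%N ->
  q%:Z * i + p%:Z * a%:Z = q%:Z * j + p%:Z * b%:Z + 1 ->
  layer_seq p q (false, true) (layer_seq p q (true, false) pulse) (q%:Z * i + p%:Z * a%:Z) =
  psum (spread 1 q pulse) i - psum (spread 1 q pulse) j.
Proof.
move=> cpq p0 aq bq E; have q0 : (0 < q)%N by lia.
rewrite /= /diff /spread; congr (psum _ _ - psum _ _); apply: idx_uniq => //.
  by split; [exists a%:Z; ring | rewrite addrAC subrr add0r -PoszM mulnC; nia].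
rewrite E addrK; split; first by exists b%:Z; ring.
by rewrite addrAC subrr add0r -PoszM mulnC; nia.
Qed.

(** From above: a window of p coefficients, each in [u - p, u]. From below: the inner letters attain
    both ends of this range, and [window_block] multiplies these values by p. *)
Lemma polyheight_extremal p q u r : prime p -> prime q -> (p < q)%N ->
  (0 < u < p)%N -> (u * q = p * r + 1)%N ->
  polyheight (word_poly p q (false, true) (true, false) (false, true) (true, false)) =
  maxn (u * p) ((p - u) * p).
Proof.
move=> pp pq ltpq up uq; have p0 := prime_gt0 pp; have q0 := prime_gt0 pq.
have npq : p != q by rewrite neq_ltn ltpq.
have cpq : coprime p q by rewrite prime_coprime // dvdn_prime2.
set f := word_poly _ _ _ _ _ _.
set c := layer_seq p q (false, true) (layer_seq p q (true, false) pulse).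
have cE : coefz f = diff p (psum (spread 1 q c)).
  by have := coefz_word (false, true) (true, false) (false, true) (true, false) pp pq npq;
     rewrite expr0 mul1r.
have cc : causal c by do 2!apply: causal_layer => //.
have low j : (p * `|c j| <= polyheight f)%N.
  rewrite -lez_nat; apply: le_trans (le_polyheight f (q%:Z * j + q%:Z - 1)).
  by rewrite cE window_block ?p0 ?(ltnW ltpq) // normrM PoszM abszE; lia.
have r0 : (0 < r < q)%N by nia.
apply/eqP; rewrite eqn_leq geq_max; apply/and3P; split.
- apply/polyheightP; rewrite cE -maxnMl mulnC; apply: bounded_window.
    by apply: causal_spread; rewrite ?coprime1n.
  apply: bounded_spread; apply: (bounded_ranges (layer_block_ranges cpq p0 q0 up uq)); lia.
(* At n = q * u, n - 1 = p * r has index 0, so the coefficient is the ramp increment from 0 to u. *)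
- apply: leq_trans (low (q%:Z * u%:Z + p%:Z * 0%N%:Z)).
  rewrite /c (@layer_block_value _ _ _ 0 _ r) //; [|lia|lia].
  rewrite [psum _ u%:Z]psum_block_lt; last by clear -up ltpq; lia.
  rewrite psum_block_lt; last by clear -q0; lia.
  by rewrite addrK mulnC.
(* At n = p * (q - r) the index is 0, while n - 1 = q * (p - u) has index p - u; the coefficient is
   u - p. *)
- apply: leq_trans (low (q%:Z * 0 + p%:Z * (q - r)%N%:Z)).
  rewrite /c (@layer_block_value _ _ _ (p%:Z - u%:Z) _ 0) //; [|lia|].
    rewrite psum_block_lt; last by clear -q0; lia.
    rewrite psum_block_lt; last by clear -up ltpq; lia.
    have -> : 0 + 1 - (p%:Z - u%:Z + 1) = - (p - u)%N%:Z by clear -up; lia.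
    by rewrite abszN mulnC.
  have : q%:Z * u%:Z = p%:Z * r%:Z + 1 by rewrite -!PoszM [(q * u)%N]mulnC uq.
  by rewrite -subzn ?mulrBr; lia.
Qed.

(** The word is Phi_p times 1 + x + ... + x^(q^3 - 1), whose coefficient at min(p, q^3) - 1 counts
    min(p, q^3) products. *)
Lemma polyheight_min_le p q : prime p -> prime q -> p != q ->
  (minn p (q ^ 3) <= polyheight (word_poly p q (false, true) (true, false) (true, false) (true, false)))%N.
Proof.
move=> pp pq npq; have p0 := prime_gt0 pp; have q0 := prime_gt0 pq.
have q30 : (0 < q ^ 3)%N by rewrite expn_gt0 q0.
set f := word_poly _ _ _ _ _ _.
have cE : coefz f = diff p (psum (spread 1 (q ^ 3) pulse)).
  have := coefz_word (false, true) (true, false) (true, false) (true, false) pp pq npq.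
  by rewrite expr0 mul1r -/f => ->; rewrite /= !spread_comp ?coprime1n ?muln_gt0 ?q0 ?mulnn -?expnSr.
have := le_polyheight f ((minn p (q ^ 3))%:Z - 1); rewrite cE; move: (polyheight f) (q ^ 3)%N q30 => H N N0 {cE}.
rewrite /diff psum_block_lt; last by lia.
by rewrite (@causal_psum _ (_ - p%:Z)); lia.
Qed.

(** * Divisors as words *)

(** Division by the monic Phi_d stays in Z[x]. The remainder vanishes at z, whose minimal polynomial
    over Q has the degree of Phi_d, so it is zero. *)
Lemma root_Cyclotomic_dvd d z f : (0 < d)%N -> d.-primitive_root z ->
  root (map_poly (intr : int -> algC) f) z -> exists g, f = g * 'Phi_d.
Proof.
move=> d0 zd rz; have Pm := Cyclotomic_monic d.
have := Pdiv.RingMonic.rdivp_eq Pm f.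
set g := Pdiv.CommonRing.rdivp _ _; set r := Pdiv.CommonRing.rmodp _ _ => fE.
exists g; suff r0 : r = 0 by rewrite {1}fE r0 addr0.
have rPhi : root (map_poly (intr : int -> algC) 'Phi_d) z.
  by rewrite (Cintr_Cyclotomic zd) root_cyclotomic.
have rr : root (map_poly (intr : int -> algC) r) z.
  have -> : r = f - g * 'Phi_d by rewrite {1}fE addrC addKr.
  by rewrite rootE rmorphB rmorphM /= hornerD hornerN hornerM (rootP rz) (rootP rPhi) mulr0 subr0.
have sr : (size r < size 'Phi_d)%N by apply: Pdiv.CommonRing.ltn_rmodpN0; rewrite ?monic_neq0.
have [m [mE mm] mP] := minCpolyP z.
have sm : size m = size 'Phi_d.
  rewrite -(size_map_poly (ratr : rat -> algC)) -mE (minCpoly_cyclotomic zd).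
  by rewrite size_cyclotomic size_Cyclotomic.
have : m %| map_poly (intr : int -> rat) r.
  rewrite -mP -map_poly_comp; suff -> : map_poly (ratr \o intr) r = map_poly (intr : int -> algC) r by [].
  by apply: eq_map_poly => x /=; rewrite ratr_int.
move=> /dvdp_leq; rewrite sm leqNgt size_map_inj_poly ?sr; [|exact: intr_inj|by []].
have [//|r0] := eqVneq r 0; move=> H; suff : false by []; apply: H.
by rewrite -size_poly_eq0 size_map_inj_poly ?size_poly_eq0 //; exact: intr_inj.
Qed.

(** A primitive d-th root of unity is a root of f or of h, so Phi_d can be cancelled from one of
    them; the mask records which. At the end only the units 1 and -1 are left. *)
Lemma prod_Cyclotomic_factor (s : seq nat) f h : all (leq 1) s ->
  f * h = \prod_(d <- s) 'Phi_d -> exists (e : bool) (m : seq bool), size m = size s /\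
    f = (-1) ^+ e * \prod_(x <- zip s m) 'Phi_(x.1) ^+ x.2.
Proof.
elim: s f h => [|d s IH] f h /=.
  rewrite big_nil => _ fh; have := size_mul_eq1 f h; rewrite fh size_poly1 eqxx.
  move=> /esym/andP[/size_poly1P[a a0 fa] /size_poly1P[b b0 hb]].
  have ab : a * b = 1 by apply: polyC_inj; rewrite polyCM -fa -hb fh.
  have : (`|a| * `|b| == 1)%N by rewrite -abszM ab.
  rewrite muln_eq1 => /andP[a1 _]; exists (a < 0), [::]; split => //=.
  rewrite big_nil mulr1 fa; have : a = 1 \/ a = -1 by lia.
  by case=> ->; rewrite ?polyCN.
move=> /andP[d0 s0]; rewrite big_cons => fh.
have [z zd] := C_prim_root_exists d0.
have Pn0 : 'Phi_d != 0 by rewrite monic_neq0 ?Cyclotomic_monic.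
have : root (map_poly (intr : int -> algC) (f * h)) z.
  by rewrite fh rmorphM rootM /= (Cintr_Cyclotomic zd) root_cyclotomic zd.
rewrite rmorphM rootM => /orP[] /(root_Cyclotomic_dvd d0 zd)[g gE].
  have /IH[//|e [m [sm mE]]] : g * h = \prod_(d <- s) 'Phi_d.
    by apply: (mulfI Pn0); rewrite -fh gE; ring.
  exists e, (true :: m); rewrite /= sm; split=> //.
  by rewrite big_cons /= gE mE expr1; ring.
have /IH[//|e [m [sm mE]]] : f * g = \prod_(d <- s) 'Phi_d.
  by apply: (mulfI Pn0); rewrite -fh gE; ring.
exists e, (false :: m); rewrite /= sm; split=> //.
by rewrite big_cons /= expr0 mul1r.
Qed.

Lemma prod_Cyclotomic_qcube p q : prime p -> prime q -> p != q ->
  'X^(p * q ^ 3) - 1 = 'Phi_1 * 'Phi_p * ('Phi_q * 'Phi_(p * q)) *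
    ('Phi_(q ^ 2) * 'Phi_(p * q ^ 2)) * ('Phi_(q ^ 3) * 'Phi_(p * q ^ 3)).
Proof.
move=> pp pq npq; rewrite -prod_Cyclotomic_prime_pfactor // !big_ord_recr big_ord0 /=.
by rewrite mul1r expn0 expn1 muln1.
Qed.

Lemma dvdZX_word p q f : prime p -> prime q -> p != q -> dvdZX f ('X^(p * q ^ 3) - 1) ->
  exists (e : bool) X0 X1 X2 X3, f = (-1) ^+ e * word_poly p q X0 X1 X2 X3.
Proof.
move=> pp pq npq [h fh]; have p0 := prime_gt0 pp; have q0 := prime_gt0 pq.
(* In this order the eight exponents read off as the four letters. *)
pose s := [:: 1; p; q; p * q; q ^ 2; p * q ^ 2; q ^ 3; p * q ^ 3]%N.
have s0 : all (leq 1) s.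
  apply/allP => d; rewrite !inE.
  by repeat case/orP; move/eqP->; rewrite ?muln_gt0 ?expn_gt0 ?p0 ?q0.
have sE : f * h = \prod_(d <- s) 'Phi_d.
  rewrite mulrC -fh prod_Cyclotomic_qcube //.
  by rewrite /s !big_cons big_nil mulr1 !mulrA.
have [e [m [sm ->]]] := prod_Cyclotomic_factor s0 sE.
case: m sm => [|s0' [|t0 [|s1 [|t1 [|s2 [|t2 [|s3 [|t3 [|]]]]]]]]] //= _.
exists e, (s0', t0), (s1, t1), (s2, t2), (s3, t3).
by rewrite !big_cons big_nil /word_poly /= mulr1 !mulrA.
Qed.

Lemma dvdZX_word_extremal p q : prime p -> prime q -> p != q ->
  dvdZX (word_poly p q (false, true) (true, false) (false, true) (true, false)) ('X^(p * q ^ 3) - 1).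
Proof.
move=> pp pq npq; exists (word_poly p q (true, false) (false, true) (true, false) (false, true)).
rewrite prod_Cyclotomic_qcube // /word_poly /=.
by move: ('Phi_1) ('Phi_p) ('Phi_q) ('Phi_(p * q)) ('Phi_(q ^ 2))
    ('Phi_(p * q ^ 2)) ('Phi_(q ^ 3)) ('Phi_(p * q ^ 3)) => *; ring.
Qed.

Lemma dvdZX_word_min p q : prime p -> prime q -> p != q ->
  dvdZX (word_poly p q (false, true) (true, false) (true, false) (true, false)) ('X^(p * q ^ 3) - 1).
Proof.
move=> pp pq npq; exists (word_poly p q (true, false) (false, true) (false, true) (false, true)).
rewrite prod_Cyclotomic_qcube // /word_poly /=.
by move: ('Phi_1) ('Phi_p) ('Phi_q) ('Phi_(p * q)) ('Phi_(q ^ 2))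
    ('Phi_(p * q ^ 2)) ('Phi_(q ^ 3)) ('Phi_(p * q ^ 3)) => *; ring.
Qed.

(** * The maximal height *)

Lemma max_divisor_height_eq n M : (0 < n)%N ->
  (forall f, dvdZX f ('X^n - 1) -> (polyheight f <= M)%N) ->
  (exists2 f, dvdZX f ('X^n - 1) & (M <= polyheight f)%N) -> max_divisor_height n = M.
Proof.
move=> n0 ub [f fd fM]; have [[g gd gE] max] := max_divisor_heightP n0.
by apply/eqP; rewrite eqn_leq -{1}gE ub // (leq_trans fM) ?max.
Qed.

Lemma max_divisor_height_qcube p q : prime p -> prime q -> (2 < p)%N -> (2 < q)%N -> p != q ->
  max_divisor_height (p * q ^ 3) = maxn (minn p (q ^ 3))
    (polyheight (word_poly p q (false, true) (true, false) (false, true) (true, false))).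
Proof.
move=> pp pq p2 q2 npq; have p0 := prime_gt0 pp; have q0 := prime_gt0 pq.
have cpq : coprime p q by rewrite prime_coprime // dvdn_prime2.
apply: max_divisor_height_eq; first by rewrite muln_gt0 expn_gt0 p0 q0.
  move=> _ /dvdZX_word[] // e [X0 [X1 [X2 [X3 ->]]]]; rewrite polyheight_sign leq_max leq_min.
  have [[-> -> -> ->]|/eqP nX] := eqVneq [:: X0; X1; X2; X3]
      [:: (false, true); (true, false); (false, true); (true, false)]; first by rewrite leqnn orbT.
  rewrite polyheight_word_qcube // andbT -(polyheight_sign X0.1); apply/orP; left.
  apply/polyheightP; rewrite coefz_word //; apply: bounded_word => //.
  by rewrite dvdn_prime2 // eq_sym.
rewrite /maxn; case: ifP => _; last first.
  by exists (word_poly p q (false, true) (true, false) (true, false) (true, false));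
    [apply: dvdZX_word_min | apply: polyheight_min_le].
by exists (word_poly p q (false, true) (true, false) (false, true) (true, false)) => //;
  apply: dvdZX_word_extremal.
Qed.

Theorem theorem1p6 (p q : nat) (hp : prime p) (hq : prime q)
    (hpo : odd p) (hqo : odd q) (hpq : p <> q)
    (rho sigma : nat)
    (hrs : (rho * p + sigma * q = (p - 1) * (q - 1))%N) :
  let h := polyheight ('Phi_p * 'Phi_q * 'Phi_(p * q ^ 2) * 'Phi_(q ^ 3))%R in
  let B := max_divisor_height (p * q ^ 3)%N in
  (B = maxn (minn p (q ^ 3)) h) /\
  ((p < q)%N -> B = h) /\
  ((q < p)%N -> (p < q ^ 2)%N -> B = maxn p h) /\
  ((q ^ 2 < p)%N -> (p < q ^ 3)%N -> B = p) /\
  ((q ^ 3 < p)%N -> B = (q ^ 3)%N) /\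
  ((p < q)%N -> B = maxn ((sigma + 1) * p) ((p - (sigma + 1)) * p)).
Proof.
have p2 := odd_prime_gt2 hpo hp; have q2 := odd_prime_gt2 hqo hq.
have npq : p != q by apply/eqP.
have hE : word_poly p q (false, true) (true, false) (false, true) (true, false) =
    'Phi_p * 'Phi_q * 'Phi_(p * q ^ 2) * 'Phi_(q ^ 3).
  by rewrite /word_poly /= !expr1 !expr0 !mul1r !mulr1.
have BE := max_divisor_height_qcube hp hq p2 q2 npq.
(* The exceptional word has two factors Phi_(q^j), hence height at most q^2; this settles the cases
   p > q^2. *)
have hq2 := polyheight_word (false, true) (true, false) (false, true) (true, false) hp hq npq.
have hext : (p < q)%N -> polyheight ('Phi_p * 'Phi_q * 'Phi_(p * q ^ 2) * 'Phi_(q ^ 3)) =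
    maxn ((sigma + 1) * p) ((p - (sigma + 1)) * p).
  move=> ltpq; have rq : (rho <= q - 1)%N.
    rewrite -(leq_pmul2r (prime_gt0 hp)); apply: leq_trans (leq_addr (sigma * q) _) _.
    by rewrite hrs mulnC leq_mul2l leq_subr orbT.
  (* Adding p + q to the relation for rho and sigma shows that sigma + 1 inverts q modulo p, with
     quotient q - 1 - rho. *)
  have E : ((sigma + 1) * q = p * (q - 1 - rho) + 1)%N.
    have {}hrs : (rho * p + sigma * q + p + q = p * q + 1)%N.
      by rewrite hrs; clear -p2 q2; nia.
    have rp : (rho * p + p <= p * q)%N.
      by rewrite -mulSnr [(p * q)%N]mulnC leq_mul2r; clear -rq q2; lia.
    by rewrite mulnDl mul1n !mulnBr muln1 [(p * rho)%N]mulnC; clear -hrs rp; lia.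
  have sp : (0 < sigma + 1 < p)%N.
    apply/andP; split; first by rewrite addn1.
    rewrite -(ltn_pmul2r (prime_gt0 hq)) E.
    have le1 : (p * (q - 1 - rho) <= p * (q - 1))%N by rewrite leq_mul2l leq_subr orbT.
    have eq2 : (p * (q - 1) + p = p * q)%N by rewrite -{2}[p]muln1 -mulnDr subnK ?prime_gt0.
    by clear -le1 eq2 p2; lia.
  by rewrite -hE (polyheight_extremal hp hq ltpq sp E).
move=> h B; rewrite hE -/h -/B in BE; rewrite hE -/h /= expn0 mul1n in hq2.
rewrite -/h in hext; clearbody h B.
have q3 : (q < q ^ 2 /\ q ^ 2 < q ^ 3)%N by rewrite !ltn_exp2l ?(ltnW q2) // -{1}[q]expn1 ltn_exp2l // ltnW.
move: (q ^ 2)%N (q ^ 3)%N q3 hq2 BE => Q2 Q3 [q12 q23] hq2 BE.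
(* As sigma + 1 >= 1, the exceptional height absorbs min(p, q^3) when p < q. *)
have hp' : (p < q)%N -> (p <= h)%N.
  by move=> /hext ->; rewrite leq_max leq_pmull // addn1.
split=> //; split=> [H|].
  by rewrite BE; have := hp' H; lia.
split=> [H H'|]; first by rewrite BE; lia.
split=> [H H'|]; first by rewrite BE; lia.
split=> H; first by rewrite BE; lia.
by rewrite -(hext H) BE; have := hp' H; lia.
Qed.
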